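(* Let $F=\langle W,R,I\rangle$ be an (8-4)-frame. Then $F$ is reflexive (i.e. $R$ is reflexive) if and only if $F\vDash\Box\varphi\to\varphi$ (for every formula $\varphi$).
   Context: Formulas (language $\mathcal{L}^{\Box,\circ}$) are built from a denumerable set $\mathrm{Var}$ of variables with unary $\neg,\Box,\circ$ and binary $\wedge,\vee$; $\alpha\to\beta:=\neg\alpha\vee\beta$, $\Diamond\alpha:=\neg\Box\neg\alpha$. (8-4)-semantics: let $B_8$ be the eight-element Boolean algebra (top $1$, bottom $0$, join $+$, meet $\cdot$, complement $-$), with $\circledcirc x=1$ if $x\in\{0,1\}$ and $\circledcirc x=0$ otherwise, and $U$ any fixed ultrafilter of $B_8$. Let $B_1,B_2,B_3$ be the three four-element Boolean subalgebras of $B_8$. An (8-4)-frame is $F=\langle W,R,I\rangle$ with $W\neq\emptyset$, $R\subseteq W\times W$, $I:W\to\{B_1,B_2,B_3\}$; write $L_w=I(w)$. A model $M$ based on $F$ adds a function $v$ with $v_w(p)=v(w,p)\in L_w$ for $w\in W$, $p\in\mathrm{Var}$. For $x\in B_8$ and $L'\in\{B_1,B_2,B_3\}$, $x^{L'}=\bigvee_{L'}\{y\in L'\mid y\leq x\}$. Each $v_w$ extends to formulas by $v_w(\neg\alpha)=-v_w(\alpha)$, $v_w(\alpha\vee\beta)=v_w(\alpha)+v_w(\beta)$, $v_w(\alpha\wedge\beta)=v_w(\alpha)\cdot v_w(\beta)$, $v_w(\circ\alpha)=\circledcirc(v_w(\alpha))$, $v_w(\Box\alpha)=\bigwedge_{L_w}\{(v_u(\alpha))^{L_w}\mid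 u\in W,\ wRu\}$. $M,w\vDash\varphi$ iff $v_w(\varphi)\in U\cap L_w$; $M\vDash\varphi$ iff $M,w\vDash\varphi$ for all $w\in W$; $F\vDash\varphi$ iff $M\vDash\varphi$ for every model $M$ based on $F$. *)

(* Defs.v *)
From mathcomp Require Import all_boot all_order.
From mathcomp Require Import boolp.

Set Implicit Arguments.
Unset Strict Implicit.
Unset Printing Implicit Defensive.

Import Order.Theory.
Local Open Scope order_scope.

Inductive form : Type :=
| Var of nat
| Neg of form
| Box of form
| Circ of form
| And of form & form
| Or of form & form.

Definition Imp (a b : form) : form := Or (Neg a) b.

(* [finCTBDistrLatticeType] is the type of finite Boolean algebras. *)
Section BooleanAlgebra.
Context {disp : Order.disp_t} {B : finCTBDistrLatticeType disp}.
Implicit Types (x y : B) (L S : {set B}).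

Definition subalgebra L : bool :=
  [&& \bot \in L, \top \in L,
      [forall x in L, ~` x \in L],
      [forall x in L, forall y in L, x `|` y \in L] &
      [forall x in L, forall y in L, x `&` y \in L]].

Definition proper_filter S : bool :=
  [&& \top \in S, \bot \notin S,
      [forall x in S, forall y, (x <= y) ==> (y \in S)] &
      [forall x in S, forall y in S, x `&` y \in S]].

Definition ultrafilter S : bool := maxset proper_filter S.

Definition circledcirc x : B :=
  if (x == \bot) || (x == \top) then \top else \bot.

(* [x^L].  Joins in a subalgebra [L] of a finite Boolean algebra are the joins
   of the ambient algebra, the empty one being [\bot]; dually for meets. *)
Definition approx L x : B := \join_(y in L | y <= x) y.

End BooleanAlgebra.

(* When [#|B| = 8] this type has exactly three elements, the algebras
   [B_1, B_2, B_3]. *)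
Definition four_subalgebra (disp : Order.disp_t)
    (B : finCTBDistrLatticeType disp) : Type :=
  {L : {set B} | subalgebra L && (#|L| == 4)}.

Record frame (disp : Order.disp_t) (B : finCTBDistrLatticeType disp) := Frame {
  world : Type;
  world_nonempty : inhabited world;
  acc : world -> world -> Prop;
  assign : world -> four_subalgebra B
}.

Section Semantics.
Context {disp : Order.disp_t} {B : finCTBDistrLatticeType disp}.
Implicit Types (F : frame B) (U : {set B}).

Definition alg F (w : world F) : {set B} := val (assign w).

Record model F := Model {
  val_var : world F -> nat -> B;
  val_var_in : forall w p, val_var w p \in alg w
}.

Fixpoint eval F (M : model F) (a : form) (w : world F) : B :=
  match a with
  | Var p => val_var M w p
  | Neg a => ~` eval M a w
  | Or a b => eval M a w `|` eval M b w
  | And a b => eval M a w `&` eval M b w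
  | Circ a => circledcirc (eval M a w)
  | Box a =>
      \meet_(x in [set x : B |
                   `[< exists2 u, acc w u & x = approx (alg w) (eval M a u) >]])
        x
  end.

Definition sat U F (M : model F) (w : world F) (a : form) : Prop :=
  eval M a w \in U :&: alg w.

Definition model_valid U F (M : model F) (a : form) : Prop :=
  forall w : world F, sat U M w a.

Definition frame_valid U F (a : form) : Prop :=
  forall M : model F, model_valid U M a.

Definition reflexive_frame F : Prop := forall w : world F, acc w w.

End Semantics.

(* Main.v *)
Require Import Defs.
From mathcomp Require Import all_boot all_order.
From mathcomp Require Import boolp.

(** Approximation from below in a subalgebra never exceeds its argument, and it
    fixes [\top]; these two facts decide the two directions.

    If [w] sees itself, then [approx L] of the value of [phi] at [w] is one of
    the elements whose meet is the value of [Box phi] at [w].  Hence that value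
    lies below the value of [phi], and [Imp (Box phi) phi] has value [\top] at
    [w].

    If [w] does not see itself, give a variable the value [\bot] at [w] and
    [\top] at every other world.  Every successor of [w] is another world, so
    the boxed variable has value [\top] at [w] while the variable has value
    [\bot]; the implication has value [\bot], which lies in no proper filter. *)

Import Order.Theory.

Section Reflexivity.
Local Open Scope order_scope.
Context {disp : Order.disp_t} {B : finCTBDistrLatticeType disp}.
Implicit Types (L U : {set B}) (F : frame B).

Lemma approx_le L x : approx L x <= x.
Proof. by apply/joinsP => y /andP[]. Qed.

Lemma approx_top L : \top \in L -> approx L \top = \top.
Proof.
by move=> topL; apply/eqP; rewrite -le1x; apply: joins_sup; rewrite topL lexx.
Qed.

Lemma alg_subalgebra F (w : world F) : subalgebra (alg w).
Proof. by case/andP: (valP (assign w)). Qed.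

(** The value at [u] need not lie in the algebra of [w]; the bound survives
    because it is approximated from below. *)
Lemma eval_Box_le F (M : model F) a (w u : world F) :
  acc w u -> eval M (Box a) w <= eval M a u.
Proof.
move=> wRu; apply: le_trans (approx_le (alg w) _).
by apply: meets_inf; rewrite inE; apply/asboolP; exists u.
Qed.

(** Approximation can lose information in general, but not on [\top], which
    all local algebras share. *)
Lemma eval_Box_top F (M : model F) a (w : world F) :
  (forall u, acc w u -> eval M a u = \top) -> eval M (Box a) w = \top.
Proof.
move=> a_top /=; apply/eqP; rewrite -le1x; apply/meetsP => x.
rewrite inE => /asboolP[u wRu ->]; rewrite a_top //.
by rewrite approx_top //; case/and5P: (alg_subalgebra F w).
Qed.

Lemma ultrafilter_proper U : ultrafilter U -> proper_filter U.
Proof. exact: maxsetp. Qed.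

Lemma frame_valid_T U F a :
  ultrafilter U -> reflexive_frame F -> frame_valid U F (Imp (Box a) a).
Proof.
move=> /ultrafilter_proper/and4P[topU _ _ _] reflF M w.
have /and5P[_ topL _ _ _] := alg_subalgebra F w.
suff eq_top : eval M (Imp (Box a) a) w = \top by rewrite /sat eq_top inE topU.
apply/eqP; rewrite -le1x -(joinCx (eval M (Box a) w)) leU2 //.
exact: eval_Box_le.
Qed.

Definition offpoint_val F (w u : world F) : B :=
  if `[< u = w >] then \bot else \top.

Lemma offpoint_val_in F (w u : world F) (p : nat) : offpoint_val F w u \in alg u.
Proof.
have /and5P[botL topL _ _ _] := alg_subalgebra F u.
by rewrite /offpoint_val; case: ifP.
Qed.

(** If [w] does not see itself, every world that it sees makes the variables
    true, while [w] does not.  Since [\bot] and [\top] belong to all local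
    algebras, this valuation is available whatever algebras [F] assigns. *)
Definition offpoint_model F (w : world F) : model F :=
  @Model _ B F (fun u _ => offpoint_val F w u) (offpoint_val_in F w).

Lemma frame_valid_T_refl U F (p : nat) :
  ultrafilter U -> frame_valid U F (Imp (Box (Var p)) (Var p)) ->
  reflexive_frame F.
Proof.
move=> /ultrafilter_proper/and4P[_ botNU _ _] validT w.
apply: contrapT => wNRw; move: (validT (offpoint_model F w) w).
have box_top : eval (offpoint_model F w) (Box (Var p)) w = \top.
  apply: eval_Box_top => u wRu /=; rewrite /offpoint_val.
  by case: asboolP => // eq_uw; case: wNRw; rewrite -{2}eq_uw.
have var_bot : eval (offpoint_model F w) (Var p) w = \bot.
  by rewrite /= /offpoint_val; case: asboolP.
have -> : sat U (offpoint_model F w) w (Imp (Box (Var p)) (Var p)) =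
          (~` eval (offpoint_model F w) (Box (Var p)) w `|`
             eval (offpoint_model F w) (Var p) w \in U :&: alg w) by [].
by rewrite box_top var_bot compl1 joinx0 inE (negPf botNU).
Qed.

End Reflexivity.

Theorem theorem5p2 (disp : Order.disp_t) (B8 : finCTBDistrLatticeType disp)
    (cardB8 : #|B8| = 8) (U : {set B8}) (ultraU : ultrafilter U)
    (F : frame B8) :
  reflexive_frame F <-> (forall phi : form, frame_valid U F (Imp (Box phi) phi)).
Proof.
split=> [reflF phi|validT]; first exact: frame_valid_T.
exact: (frame_valid_T_refl U F 0 ultraU (validT _)).
Qed.
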